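(* Let $F$ be the reduced objective defined in the context and let $P\succ0$ be a symmetric positive definite matrix. Suppose there exists a constant $L_P>0$ such that $$\sup_{\theta\in\Theta}\left\|P^{1/2}\nabla^2F(\theta)P^{1/2}\right\|\le L_P.$$ Let $\{\theta^k\}$ be generated by $\theta^{k+1}=\theta^k-\eta P\nabla F(\theta^k)$ with a constant step size $\eta>0$. If $0<\eta<\frac{2}{L_P}$, then the following hold: 1. (Descent) for every $k$, $$F(\theta^{k+1})\le F(\theta^k)-\eta\Big(1-\frac{\eta L_P}{2}\Big)\|\nabla F(\theta^k)\|_P^2.$$ 2. (Summability of preconditioned gradients) $$\sum_{k=0}^\infty\|\nabla F(\theta^k)\|_P^2\le\frac{F(\theta^0)-\inf_{\theta\in\Theta}F(\theta)}{\eta\big(1-\frac{\eta L_P}{2}\big)}.$$ 3. (Stationarity) for every $K\ge1$, $$\min_{0\le j\le K-1}\|\nabla F(\theta^j)\|_P^2\le\frac{F(\theta^0)-\inf_{\theta\in\Theta}F(\theta)}{K\,\eta\big(1-\frac{\eta L_P}{2}\big)}.$$ In particular, $\lim_{k\to\infty}\|\nabla F(\theta^k)\|_P=0$.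
   Context: $C\subset\mathbb{R}^m$ is a nonempty compact set (of feasible control sequences), $f_0$ is a continuous real-valued objective, and $\tau>0$. $\Theta\subseteq\mathbb{R}^p$ is a parameter space and, for each $\theta\in\Theta$, $\pi_\theta$ is a probability density on $\mathbb{R}^m$. Define $$Z(\theta):=\int_C\pi_\theta(u)e^{-f_0(u)/\tau}\,du,\qquad F(\theta):=-\tau\log Z(\theta),$$ where $Z(\theta)>0$ since $\pi_\theta$ is positive on $C$. Standing assumption: the family $\{\pi_\theta\}_{\theta\in\Theta}$ is strictly positive on $C$, twice continuously differentiable in $\theta$, and such that differentiation under the integral sign is valid for $Z(\theta)$ up to second order; under it $F$ is twice differentiable. Notation: $\|\cdot\|$ of a matrix is the spectral norm; $\|x\|_P^2:=x^\top Px$.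
   Formalization: The formal theorem additionally assumes that all iterates and the line segments joining consecutive iterates lie in Θ (automatic for Θ = ℝ^p, or for convex Θ with iterates in Θ); for a disconnected Θ the descent claim can fail without this. *)

(* Defs.v *)
(* MathComp and MathComp-Analysis. A vector of R^n is a column 'cV[R]_n, whose
   library norm is the max norm; its topology is the usual one. *)
From HB Require Import structures.
From mathcomp Require Import all_boot all_order all_algebra.
From mathcomp Require Import all_classical all_reals all_analysis.
From mathcomp Require Import measurable_realfun.
Import Order.TTheory GRing.Theory Num.Theory.
Import numFieldNormedType.Exports.

Set Implicit Arguments.
Unset Strict Implicit.
Unset Printing Implicit Defensive.

Local Open Scope classical_set_scope.
Local Open Scope ring_scope.

(* The canonical measurable structure on matrices is the Borel sigma-algebra. *)
Section borel.
Variables (R : realType) (m n : nat).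
Let opens : set (set 'M[R]_(m, n)) := open.

HB.instance Definition _ := @isMeasurable.Build (sigma_display opens)
  'M[R]_(m, n) <<s opens >> (@sigma_algebra0 _ setT opens)
  (@sigma_algebraC _ opens) (@sigma_algebra_bigcup _ setT opens).

End borel.

Section lebesgue_step.
Variables (R : realType) (n : nat).

Definition cV_cons (z : measurableTypeR R * 'cV[R]_n) : 'cV[R]_(1 + n) :=
  col_mx (z.1 : R)%:M z.2.

Lemma open_measurable_mx m k (U : set 'M[R]_(m, k)) : open U -> measurable U.
Proof. by move=> oU; exact: sub_sigma_algebra. Qed.

Lemma near_rat (e : R) (x : R) : 0 < e -> exists q : rat, ball (ratr q : R) e x.
Proof.
move=> e0; have : x - e < x + e by rewrite ltrBlDr -addrA ltrDl addr_gt0.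
move=> /rat_in_itvoo[q]; rewrite in_itv /= => /andP[h1 h2]; exists q.
by rewrite /ball /= ltr_distlC ltrBlDr h2 /= -ltrBlDr.
Qed.

Lemma measurable_cV_cons : measurable_fun setT cV_cons.
Proof.
apply: (@measurability _ _ _ _ _ _ (open : set (set 'cV[R]_(1 + n)))) => //.
move=> _ [U oU <-]; rewrite setTI.
pose B (i : rat * 'cV[rat]_n * nat) : set (measurableTypeR R * 'cV[R]_n) :=
  (ball (ratr i.1.1 : R) i.2.+1%:R^-1 : set R)
    `*` ball (map_mx ratr i.1.2 : 'cV[R]_n) i.2.+1%:R^-1.
have mB i : measurable (B i).
  apply: measurableX.
    by apply: open_measurable; apply: ball_open; rewrite invr_gt0.
  by apply: open_measurable_mx; apply: ball_open; rewrite invr_gt0.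
have -> : cV_cons @^-1` U =
    \bigcup_(i in [set i | B i `<=` cV_cons @^-1` U]) B i.
  apply/seteqP; split => [[x v] Uxv|z [i /= Bi /Bi]] //.
  have /nbhs_ballP[e /= e0 eU] : nbhs (cV_cons (x, v)) U.
    by apply: open_nbhs_nbhs.
  have [k ke] : exists k : nat, (k.+1%:R^-1 : R) < e / 2.
    have e20 : 0 < e / 2 by rewrite divr_gt0.
    have [k /= _ /(_ _ (leqnn k))] := near_infty_natSinv_lt (PosNum e20).
    by exists k.
  have k0 : 0 < (k.+1%:R^-1 : R) by rewrite invr_gt0.
  have [q qx] := near_rat x k0.
  have /choice[w wv] : forall j, exists q : rat,
    ball (ratr q : R) (k.+1%:R^-1 : R) (v j ord0) by move=> j; exact: near_rat.
  have Bxv : B (q, \col_j w j, k) (x, v).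
    by split => //=; split => // i j; rewrite !mxE (ord1 j).
  exists (q, \col_j w j, k) => //= -[y u] [/= qy [_ wu]].
  apply: eU; split => // i j; rewrite (ord1 j) /cV_cons /=.
  have key (a b c : R) : ball a k.+1%:R^-1 b -> ball a k.+1%:R^-1 c ->
      ball b e c.
    move=> /ball_sym ab ac.
    have ke2 : (k.+1%:R^-1 : R) <= e / 2 by exact: ltW.
    by rewrite (splitr e); apply: ball_triangle (le_ball ke2 ab) (le_ball ke2 ac).
  rewrite -[i]splitK; case: (fintype.split i) => i' /=.
    by rewrite !col_mxEu (ord1 i') !mxE /= !mulr1n; exact: key qx qy.
  rewrite !col_mxEd; apply: key (wv i') _.
  by have := wu i' ord0; rewrite !mxE.
rewrite bigcup_mkcond; apply: countable_bigcupT_measurable => [|i].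
  exact: countableP.
by case: ifP.
Qed.

Lemma measurable_cV_head :
  measurable_fun setT (fun x : 'cV[R]_(1 + n) => x (lshift n ord0) ord0 : R).
Proof.
apply: (@measurability _ _ _ _ _ _ _ (RGenOpens.measurableE R)).
move=> _ [U [a [b ->]] <-]; rewrite setTI; apply: open_measurable_mx.
apply: open_comp; last exact: interval_open.
by move=> x _; exact: coord_continuous.
Qed.

Lemma measurable_cV_tail :
  measurable_fun setT (dsubmx : 'cV[R]_(1 + n) -> 'cV[R]_n).
Proof.
apply: (@measurability _ _ _ _ _ _ (open : set (set 'cV[R]_n))) => //.
move=> _ [U oU <-]; rewrite setTI; apply: open_measurable_mx.
apply: open_comp => // x _ A /nbhs_ballP[e /= e0 eA].
apply/nbhs_ballP; exists e => // y [_ xy].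
by apply: eA; split => // i j; rewrite !mxE; exact: xy.
Qed.

Variable mu : {sigma_finite_measure set 'cV[R]_n -> \bar R}.

Definition lebesgue_step : set 'cV[R]_(1 + n) -> \bar R :=
  pushforward (@lebesgue_measure R \x mu)%E cV_cons.

Let lebesgue_step0 : lebesgue_step set0 = 0%E.
Proof. by rewrite /lebesgue_step /pushforward preimage_set0 measure0. Qed.

Let lebesgue_step_ge0 A : (0 <= lebesgue_step A)%E.
Proof. by rewrite /lebesgue_step /pushforward measure_ge0. Qed.

Let lebesgue_step_sigma_additive : semi_sigma_additive lebesgue_step.
Proof.
have mconsI A (mA : measurable A) : measurable (cV_cons @^-1` A).
  by rewrite -[X in measurable X]setTI; exact: measurable_cV_cons.
move=> F mF tF mUF; rewrite /lebesgue_step /pushforward preimage_bigcup.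
apply: measure_semi_sigma_additive => [k||].
- exact: mconsI.
- apply/trivIsetP => i j _ _ ij; rewrite -preimage_setI.
  by move/trivIsetP : tF => /(_ _ _ _ _ ij) ->//; rewrite preimage_set0.
- by rewrite -preimage_bigcup; exact: mconsI.
Qed.

HB.instance Definition _ := isMeasure.Build _ _ _ lebesgue_step
  lebesgue_step0 lebesgue_step_ge0 lebesgue_step_sigma_additive.

Let lebesgue_step_sigma_finite : sigma_finite setT lebesgue_step.
Proof.
have /sigma_finiteP[F [TF ndF Foo]] := sigma_finiteT (@lebesgue_measure R).
have /sigma_finiteP[G [TG ndG Goo]] := sigma_finiteT mu.
exists (fun k => (fun x : 'cV[R]_(1 + n) => x (lshift n ord0) ord0 : R) @^-1` F k
  `&` dsubmx @^-1` G k).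
  rewrite predeqE => x; split=> // _.
  have [i _ Fi] : (\bigcup_i F i) (x (lshift n ord0) ord0) by rewrite -TF.
  have [j _ Gj] : (\bigcup_i G i) (dsubmx x) by rewrite -TG.
  exists (maxn i j) => //; split => /=.
  - by move: (x _ _) Fi; exact/subsetPset/ndF/leq_maxl.
  - by move: (dsubmx x) Gj; exact/subsetPset/ndG/leq_maxr.
move=> k; have [mF Fk] := Foo k; have [mG Gk] := Goo k; split.
  apply: measurableI; rewrite -[X in measurable X]setTI.
  - exact: measurable_cV_head.
  - exact: measurable_cV_tail.
rewrite /lebesgue_step /pushforward.
rewrite (_ : _ @^-1` _ = F k `*` G k).
  by rewrite product_measure1E// lte_mul_pinfty// ge0_fin_numE.
apply/seteqP; split => -[a v] /=; rewrite /cV_cons col_mxEu mxE col_mxKd mulr1n.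
  by [].
by [].
Qed.

HB.instance Definition _ := Measure_isSigmaFinite.Build _ _ _ lebesgue_step
  lebesgue_step_sigma_finite.

End lebesgue_step.

(* Lebesgue measure on R^n, as the image of the iterated product measure
   lambda (x) (lambda (x) ...) under (a, v) |-> [a; v]. *)
Fixpoint lebesgue_cV (R : realType) (n : nat) :
    {sigma_finite_measure set 'cV[R]_n -> \bar R} :=
  if n is n'.+1 then lebesgue_step (lebesgue_cV R n') else \d_(0 : 'cV[R]_0).

Section calculus.
Variables (R : realType) (p : nat).
Implicit Types (f : 'cV[R]_p -> R) (t : 'cV[R]_p).

Definition grad f t : 'cV[R]_p := \col_i 'D_(delta_mx i ord0) f t.

Definition hessian f t : 'M[R]_p :=
  \matrix_(i, j) 'D_(delta_mx j ord0) ('D_(delta_mx i ord0) f) t.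

(* Differentiability is Frechet differentiability in the ambient space R^p. *)
Definition twice_differentiable f t :=
  (\forall s \near t, differentiable f s) /\ differentiable (grad f) t.

(* For an open set Theta this is the usual notion; for a general Theta it says
   that f, defined around Theta, has its derivatives at the points of Theta. *)
Definition C2_on (Theta : set 'cV[R]_p) f :=
  (forall t, Theta t -> twice_differentiable f t) /\
  {within Theta, continuous (hessian f)}.

End calculus.

Section matrix_norms.
Variables (R : realType) (n : nat).
Implicit Types (A P Q : 'M[R]_n) (x : 'cV[R]_n).

Definition quad P x : R := (x^T *m P *m x) ord0 ord0.

Definition posdef P := P^T = P /\ forall x, x != 0 -> 0 < quad P x.

Definition possemidef P := P^T = P /\ forall x, 0 <= quad P x.

(* P^(1/2): the positive semidefinite square root, which exists and is unique
   for P positive semidefinite; the default value 0 is then never used. *)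
Definition sqrtmx P : 'M[R]_n := xget 0 [set Q | possemidef Q /\ Q *m Q = P].

(* The norm `|x| of the library is the max norm, hence these definitions. *)
Definition norm2 x : R := Num.sqrt ((x^T *m x) ord0 ord0).

Definition spectral_norm A : R :=
  sup [set norm2 (A *m x) | x in [set x | norm2 x <= 1]].

Definition wnorm P x : R := Num.sqrt (quad P x).

End matrix_norms.

Section reduced_objective.
Variables (R : realType) (m p : nat).
Variables (C : set 'cV[R]_m) (f0 : 'cV[R]_m -> R) (tau : R).
Variables (Theta : set 'cV[R]_p) (dens : 'cV[R]_p -> 'cV[R]_m -> R).

Definition probability_density (h : 'cV[R]_m -> R) :=
  [/\ measurable_fun setT h, forall u, 0 <= h u &
      (\int[lebesgue_cV R m]_u (h u)%:E = 1)%E].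

Definition weight (u : 'cV[R]_m) : R := expR (- (f0 u / tau)).

Definition partition_function (t : 'cV[R]_p) : R :=
  \int[lebesgue_cV R m]_(u in C) (dens t u * weight u).

Definition reduced_objective (t : 'cV[R]_p) : R :=
  - tau * ln (partition_function t).

(* On Theta, the partition function is twice differentiable and its first and
   second derivatives are the (absolutely convergent) integrals over C of those
   of the integrand. *)
Definition leibniz_rule_order2 := forall t, Theta t ->
  [/\ twice_differentiable partition_function t,
      forall i,
        (lebesgue_cV R m).-integrable C
          (fun u => (grad (dens ^~ u) t i ord0 * weight u)%:E) /\
        grad partition_function t i ord0 =
          \int[lebesgue_cV R m]_(u in C)
            (grad (dens ^~ u) t i ord0 * weight u) &
      forall i j,
        (lebesgue_cV R m).-integrable C
          (fun u => (hessian (dens ^~ u) t i j * weight u)%:E) /\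
        hessian partition_function t i j =
          \int[lebesgue_cV R m]_(u in C)
            (hessian (dens ^~ u) t i j * weight u)].

End reduced_objective.

(* Main.v *)
Require Import Defs.
From HB Require Import structures.
From mathcomp Require Import all_boot all_order all_algebra.
From mathcomp Require Import complex.
From mathcomp Require Import ring lra.
From mathcomp Require Import all_classical all_reals all_analysis.
From mathcomp Require Import measurable_realfun.
Import Order.TTheory GRing.Theory Num.Theory.
Import numFieldNormedType.Exports.

(** The proof is the descent lemma in the metric of [P], followed by telescoping.

    Along the segment from [theta k] to [theta k.+1 = theta k - eta P g], where
    [g] is the gradient of [F] at [theta k], Taylor's inequality bounds
    [F (theta k.+1)] by [F (theta k) - eta g^T P g] plus half the supremum of the
    second-order term [eta^2 (P g)^T H (P g)] ([le_second_order]). Writing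
    [P = S S] with [S] the positive semidefinite square root, this term is
    [eta^2 (S g)^T (S H S) (S g)], at most [eta^2 L g^T P g] when the spectral
    norm of [S H S] is at most [L] ([quad_preconditioned_le]). This is the descent
    inequality ([preconditioned_descent]). Since [F] is bounded below on [Theta]
    ([reduced_objective_bounded_below]), summing it over [k] bounds the series of
    the [g^T P g]; the bound on the minimum and the convergence to 0 follow.

    Three facts that the argument takes for granted carry most of the work.
    - The root [S] exists ([exists_possemidef_sqrt]). It is obtained as a
      polynomial in [P] from the spectral theorem over the complex numbers.
    - [F = - tau ln Z] is twice differentiable on [Theta]. This follows from the
      regularity of [Z] where [Z > 0]; when [C] has measure zero, [Z] is 0 and
      [F] is constant ([twice_differentiable_reduced_objective]).
    - The infimum of [F] is a lower bound, because [Z <= exp (- min f0 / tau)]. *)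

Local Open Scope classical_set_scope.
Local Open Scope ring_scope.

(** * Square roots of positive semidefinite matrices *)

Lemma exists_interpolation (K : fieldType) (g : K -> K) (s : seq K) :
  exists r : {poly K}, forall x, x \in s -> r.[x] = g x.
Proof.
elim: s => [|a s [r rg]]; first by exists 0.
have [as_|as_] := boolP (a \in s).
  by exists r => x; rewrite inE => /orP[/eqP ->|]; exact: rg.
pose q : {poly K} := \prod_(b <- s) ('X - b%:P).
have q0 x : x \in s -> q.[x] = 0 by rewrite -root_prod_XsubC => /rootP.
have qa : q.[a] != 0 by rewrite -[_ == 0]/(root q a) root_prod_XsubC.
exists (r + ((g a - r.[a]) / q.[a]) *: q) => x.
rewrite inE hornerD hornerZ => /orP[/eqP ->|xs].
  by rewrite divfK// addrC subrK.
by rewrite (q0 x xs) mulr0 addr0 rg.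
Qed.

Section symmetric_matrices.
Variables (R : realType) (n : nat).
Implicit Types (P A Q : 'M[R]_n) (x : 'cV[R]_n).

Lemma dot_ge0 x : 0 <= (x^T *m x) ord0 ord0.
Proof. by rewrite mxE; apply: sumr_ge0 => i _; rewrite mxE -expr2 sqr_ge0. Qed.

Lemma norm2_sqr x : norm2 x ^+ 2 = (x^T *m x) ord0 ord0.
Proof. by rewrite sqr_sqrtr// dot_ge0. Qed.

Lemma norm2_eq0 x : (norm2 x == 0) = (x == 0).
Proof.
rewrite -sqrf_eq0 norm2_sqr mxE psumr_eq0; last first.
  by move=> i _; rewrite mxE -expr2 sqr_ge0.
apply/allP/eqP => [x0|-> i _]; last by rewrite !mxE mulr0 eqxx.
apply/colP => i; have := x0 i (mem_index_enum i).
by rewrite !mxE -expr2 sqrf_eq0 => /eqP.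
Qed.

Lemma possemidef_eigenvalue_ge0 P (a : R) :
  possemidef P -> eigenvalue P a -> 0 <= a.
Proof.
move=> [_ P0] /eigenvalueP[v vP v0].
have := P0 v^T; rewrite /quad trmxK vP -scalemxAl mxE.
rewrite pmulr_lge0// lt_neqAle.
have := norm2_sqr v^T; rewrite trmxK => <-; rewrite sqr_ge0 andbT eq_sym.
by rewrite sqrf_eq0 norm2_eq0 trmx_eq0.
Qed.

End symmetric_matrices.

(** The complexification of [P] is Hermitian, hence unitarily diagonalizable with
    real eigenvalues, each of which is an eigenvalue of [P] itself; conjugating
    by the unitary matrix turns [q(P)] into the diagonal matrix of the [q(a)].
    As [q] has real coefficients, its vanishing at the complex matrix gives its
    vanishing at [P]. *)
Lemma symmetric_horner_eq0 (R : realType) (n : nat) (P : 'M[R]_n.+1)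
    (q : {poly R}) :
  P^T = P -> (forall a, eigenvalue P a -> q.[a] = 0) -> horner_mx P q = 0.
Proof.
move=> PT q0; pose f := real_complex R; pose A := map_mx f P.
have Ar : A \is a mxOver Num.real.
  by apply/mxOverP => i j; rewrite mxE; apply/complex_realP; exists (P i j).
have Asym : A \is hermitianmx _ false idfun.
  apply/is_hermitianmxP; rewrite scale1r map_mx_id//.
  by apply/matrixP => i j; rewrite !mxE -[in LHS]PT mxE.
have /orthomx_spectralP Aspec := symmetric_normalmx Asym Ar.
have dr := hermitian_spectral_diag_real (realsym_hermsym Asym Ar).
set U := spectralmx A in Aspec; set d := spectral_diag A in Aspec dr.
have Uu : U \in unitmx := spectral_unit A.
(* The rows of U are eigenvectors, so each d_i is a root of char_poly P. *)
have qd i : (map_poly f q).[d ord0 i] = 0.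
  have /complex_realP[a da] : d ord0 i \is Num.real by move/mxOverP : dr.
  rewrite da -/(f a) horner_map q0 ?rmorph0//.
  rewrite eigenvalue_root_char -(fmorph_root f) map_char_poly -/A -/(f a).
  rewrite -eigenvalue_root_char; apply/eigenvalueP; exists (row i U).
    rewrite {1}Aspec -row_mul !mulmxA mulmxV// mul1mx.
    by rewrite row_mul row_diag_mx -scalemxAl -rowE da.
  apply/eqP => Ui0; have : row i (U *m invmx U) = 0.
    by rewrite row_mul Ui0 mul0mx.
  rewrite mulmxV// => /rowP/(_ i); rewrite !mxE eqxx => /eqP.
  by rewrite oner_eq0.
apply: (map_mx_inj (f := f)); rewrite map_horner_mx map_mx0.
rewrite -[map_mx _ P]/A Aspec horner_mx_uconjC// horner_mx_diag.
rewrite [map_mx _ d](_ : _ = 0) ?linear0 ?mulmx0 ?mul0mx//.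
by apply/rowP => i; rewrite !mxE.
Qed.

(** Complex roots are used because the characteristic polynomial splits there;
    the real parts of its roots include the real ones. *)
Lemma exists_eigenvalue_seq (R : realType) (n : nat) (P : 'M[R]_n) :
  exists s : seq R, forall a, eigenvalue P a -> a \in s.
Proof.
pose f := real_complex R.
have [r pr] := closed_field_poly_normal (map_poly f (char_poly P)).
exists (map (@complex.Re R) r) => a.
rewrite eigenvalue_root_char -(fmorph_root f) pr rootZ; last first.
  by rewrite lead_coef_eq0 map_poly_eq0 monic_neq0// char_poly_monic.
by rewrite root_prod_XsubC => ar; apply/mapP; exists (f a).
Qed.

Lemma trmx_horner_mx (K : comNzRingType) (n : nat) (A : 'M[K]_n.+1)
    (r : {poly K}) : (horner_mx A r)^T = horner_mx A^T r.
Proof.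
elim/poly_ind: r => [|r c IH]; first by rewrite !rmorph0 trmx0.
rewrite !rmorphD !rmorphM/= !horner_mx_C !horner_mx_X linearD/= tr_scalar_mx.
by rewrite trmx_mul IH; congr (_ + _); exact: comm_mx_horner.
Qed.

(** The root is a polynomial in [P]: if [r] interpolates the fourth root at the
    eigenvalues of [P] and [B = r(P)], then [r^4 - X] vanishes at them, so
    [B^4 = P]. The fourth root, instead of the square root, makes the
    positivity of [Q = B^2 = B^T B] immediate. *)
Lemma exists_possemidef_sqrt (R : realType) (n : nat) (P : 'M[R]_n) :
  possemidef P -> exists Q, possemidef Q /\ Q *m Q = P.
Proof.
case: n P => [|n] P [PT P0].
  exists 0; split; last by rewrite [P]flatmx0 mulmx0.
  by split=> [|x]; [rewrite trmx0|rewrite /quad mulmx0 mul0mx mxE].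
have [s Ps] := exists_eigenvalue_seq _ _ P.
have [r rs] := exists_interpolation _ (fun a : R => Num.sqrt (Num.sqrt a)) s.
pose B := horner_mx P r.
have BT : B^T = B by rewrite trmx_horner_mx PT.
exists (B *m B); split; first split; first by rewrite trmx_mul BT.
  move=> x; rewrite /quad -{1}BT !mulmxA -trmx_mul -mulmxA; exact: dot_ge0.
apply/eqP; rewrite -subr_eq0 -[X in _ - X](horner_mx_X P) !mulmxE -!rmorphM -rmorphB/=.
apply/eqP/symmetric_horner_eq0 => // a Pa.
have a0 : 0 <= a by apply: (possemidef_eigenvalue_ge0 _ _ P).
rewrite hornerD hornerN hornerX !hornerM rs ?Ps//.
have -> (y : R) : y * y * (y * y) = (y ^+ 2) ^+ 2 by ring.
by rewrite !sqr_sqrtr ?subrr ?sqrtr_ge0.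
Qed.

(** * The spectral norm and preconditioned quadratic forms *)

Section spectral_norm_bound.
Variables (R : realType) (n : nat).
Implicit Types (P A S H : 'M[R]_n) (x g : 'cV[R]_n).

Lemma norm2_ge0 x : 0 <= norm2 x.
Proof. exact: sqrtr_ge0. Qed.

Lemma norm2Z (a : R) x : norm2 (a *: x) = `|a| * norm2 x.
Proof.
rewrite -[`|a|]sqrtr_sqr -sqrtrM ?sqr_ge0//; congr Num.sqrt.
by rewrite !mxE mulr_sumr; apply: eq_bigr => i _; rewrite !mxE; ring.
Qed.

(** In the unit ball each coordinate is at most 1 in absolute value, so the
    absolute row sums of [A] bound the coordinates of [A x]. *)
Lemma has_ubound_norm2_mulmx A :
  has_ubound [set norm2 (A *m x) | x in [set x | norm2 x <= 1]].
Proof.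
pose b i := \sum_j `|A i j|.
exists (Num.sqrt (\sum_i b i ^+ 2)) => _ [x /= x1 <-].
apply: ler_wsqrtr; rewrite mxE; apply: ler_sum => i _; rewrite mxE -expr2.
have xle1 j : `|x j ord0| <= 1.
  rewrite -(@ler_pXn2r _ 2) ?nnegrE// expr1n real_normK ?num_real//.
  have : norm2 x ^+ 2 <= 1 by rewrite expr_le1// norm2_ge0.
  apply: le_trans; rewrite norm2_sqr mxE (bigD1 j)//= mxE -expr2 lerDl.
  by apply: sumr_ge0 => k _; rewrite mxE -expr2 sqr_ge0.
rewrite -real_normK ?num_real// ler_pXn2r ?nnegrE ?sumr_ge0//.
rewrite mxE (le_trans (ler_norm_sum _ _ _))//; apply: ler_sum => j _.
by rewrite normrM ler_piMr.
Qed.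

(** The supremum defining the spectral norm is a genuine upper bound only because
    the set is bounded. *)
Lemma norm2_mulmx_le A x : norm2 (A *m x) <= spectral_norm A * norm2 x.
Proof.
have [->|x0] := eqVneq x 0.
  by rewrite mulmx0 (_ : norm2 0 = 0) ?mulr0//; apply/eqP; rewrite norm2_eq0.
have nx0 : 0 < norm2 x by rewrite lt_neqAle norm2_ge0 eq_sym norm2_eq0 x0.
rewrite -ler_pdivrMr//; apply: ub_le_sup; first exact: has_ubound_norm2_mulmx.
exists ((norm2 x)^-1 *: x) => /=.
  by rewrite norm2Z gtr0_norm ?invr_gt0// mulVf ?gt_eqF.
by rewrite -scalemxAr norm2Z gtr0_norm ?invr_gt0// mulrC.
Qed.

(** A variant of the Cauchy-Schwarz inequality: expand
    [0 <= |c x - A x|^2] and bound [|A x|] by [c |x|]. *)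
Lemma quad_le_spectral_norm A x (c : R) : 0 < c -> spectral_norm A <= c ->
  quad A x <= c * quad 1%:M x.
Proof.
move=> c0 Ac.
have Ax : norm2 (A *m x) ^+ 2 <= c ^+ 2 * norm2 x ^+ 2.
  rewrite -exprMn ler_pXn2r ?nnegrE ?mulr_ge0 ?norm2_ge0 ?(ltW c0)//.
  by rewrite (le_trans (norm2_mulmx_le A x))// ler_wpM2r ?norm2_ge0.
have dotE (y z : 'cV[R]_n) :
    (y^T *m z) ord0 ord0 = \sum_i y i ord0 * z i ord0.
  by rewrite mxE; apply: eq_bigr => i _; rewrite mxE.
have : 0 <= \sum_i (c * x i ord0 - (A *m x) i ord0) ^+ 2.
  by apply: sumr_ge0 => i _; rewrite sqr_ge0.
have -> : \sum_i (c * x i ord0 - (A *m x) i ord0) ^+ 2 =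
    c ^+ 2 * norm2 x ^+ 2 - 2 * c * quad A x + norm2 (A *m x) ^+ 2.
  rewrite !norm2_sqr /quad -mulmxA !dotE !mulr_sumr -sumrB -big_split/=.
  by apply: eq_bigr => i _; ring.
move=> Acx; rewrite [quad 1%:M x]/quad mulmx1 -norm2_sqr.
rewrite -(@ler_pM2l _ (2 * c)) ?mulr_gt0//; lra.
Qed.

(** With [S] the square root of [P] and [z = S g], the left-hand side is the
    quadratic form of [S H S] at [z], and [|z|^2 = g^T P g]. *)
Lemma quad_preconditioned_le P H g (c : R) : possemidef P -> 0 < c ->
  spectral_norm (sqrtmx P *m H *m sqrtmx P) <= c ->
  quad H (P *m g) <= c * quad P g.
Proof.
move=> psdP c0 Hc; have [[ST _] SS] := xgetPex 0 (exists_possemidef_sqrt _ _ _ psdP).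
rewrite -/(sqrtmx P) in ST SS.
have := quad_le_spectral_norm _ (sqrtmx P *m g) _ c0 Hc.
rewrite /quad !trmx_mul ST mulmx1 !mulmxA.
have [PT _] := psdP; rewrite PT -[X in X *m H]mulmxA.
by rewrite -!mulmxA !(mulmxA (sqrtmx P) (sqrtmx P)) SS !mulmxA.
Qed.

End spectral_norm_bound.

(** * Frechet derivatives of functions of a column vector *)

Section differentiability.
Variable R : realType.

Lemma near_eq_differentiable (V W : normedModType R) (f g : V -> W) (x : V) :
  (\near x, f x = g x) -> differentiable f x -> differentiable g x.
Proof.
move=> fg df; have fgx : f x = g x by exact: nbhs_singleton fg.
have dfc := diff_continuous df.
have gE : g \o shift x = cst (g x) + 'd f x +o_ 0 id.
  apply/eqaddoP => e e0.
  have /eqaddoP/(_ e e0) := diff_locally df.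
  have : \forall h \near (0 : V), f (h + x) = g (h + x).
    by move: fg; rewrite (near_shift (0 : V)) subr0.
  move=> fgh fo; near=> h.
  have fgh_ : f (h + x) = g (h + x) by near: h.
  have : `|(f \o shift x - (cst (f x) + 'd f x)) h| <= e * `|id h| by near: h.
  by rewrite !fctE /= fgh_ fgx.
by apply/diff_locallyP; rewrite (diff_unique dfc gE).
Unshelve. all: by end_near. Qed.

Lemma col_sum_delta (n : nat) (x : 'cV[R]_n) :
  x = \sum_i x i ord0 *: delta_mx i ord0.
Proof.
apply/colP => i; rewrite summxE (bigD1 i)//= !mxE !eqxx mulr1 big1 ?addr0//.
by move=> j ji; rewrite !mxE eq_sym (negbTE ji) mulr0.
Qed.

Lemma differentiable_col (V : normedModType R) (n : nat) (f : V -> 'cV[R]_n)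
    (x : V) :
  (forall i, differentiable (fun y => f y i ord0) x) -> differentiable f x.
Proof.
move=> df; have -> : f = \sum_i (fun y => f y i ord0 *: delta_mx i ord0).
  by apply/funext => y; rewrite fct_sumE [LHS]col_sum_delta.
by apply: differentiable_sum => i; exact: differentiableZl.
Qed.

Lemma differentiable_colE (V : normedModType R) (n : nat) (f : V -> 'cV[R]_n)
    (x : V) i : differentiable f x -> differentiable (fun y => f y i ord0) x.
Proof.
move=> df; apply: (@differentiable_comp _ _ _ _ f (fun M : 'cV[R]_n => M i ord0)) => //.
exact: differentiable_coord.
Qed.

(** Frechet differentiability reduces every directional derivative to the
    partial derivatives that make up the gradient. *)
Lemma derive_grad (n : nat) (f : 'cV[R]_n -> R) (t d : 'cV[R]_n) :
  differentiable f t -> 'D_d f t = ((grad f t)^T *m d) ord0 ord0.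
Proof.
move=> df; rewrite deriveE// mxE [in LHS](col_sum_delta _ d) linear_sum.
by apply: eq_bigr => i _; rewrite linearZ/= -deriveE// !mxE mulrC.
Qed.

(** Near [t] the function [Z] stays positive and the gradient is
    [(a / Z) *: grad Z], a differentiable expression; the formula is needed on a
    neighbourhood, since [ln] is constant on the nonpositive reals. *)
Lemma twice_differentiable_ln (n : nat) (a : R) (Z : 'cV[R]_n -> R) t :
  0 < Z t -> twice_differentiable Z t ->
  twice_differentiable (fun s => a * ln (Z s)) t.
Proof.
move=> Zt [dZ dgZ].
have dZt : differentiable Z t := nbhs_singleton dZ.
have nZ : \forall s \near t, 0 < Z s.
  have := differentiable_continuous dZt.
  by move=> /cvgr_gt; apply.
have dln s : differentiable Z s -> 0 < Z s ->
    differentiable (fun s => a * ln (Z s)) s /\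
    forall v, 'D_v (fun s => a * ln (Z s)) s = a / Z s * 'D_v Z s.
  move=> dZs Zs0.
  have Dln := @is_derive1_ln R _ Zs0.
  have dl : differentiable (@ln R) (Z s).
    by apply/derivable1_diffP; exact: ex_derive.
  have dlZ : differentiable (@ln R \o Z) s by exact: differentiable_comp.
  have dalZ : differentiable (fun s => a * ln (Z s)) s.
    by have := differentiableM (differentiable_cst a s) dlZ; apply.
  split=> // v; rewrite !deriveE//.
  have -> : (fun s => a * ln (Z s)) = a *: (@ln R \o Z) by [].
  rewrite diffZ// diff_comp// diff1E// derive1E derive_val.
  by rewrite /= /GRing.scale/=; ring.
split; first by near=> s; apply: (dln s _ _).1; near: s.
apply: differentiable_col => i.
have dgi := differentiable_colE _ _ _ _ i dgZ.
apply: (near_eq_differentiable _ _ (fun s => a / Z s * grad Z s i ord0)).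
  near=> s; rewrite !mxE.
  have dZs : differentiable Z s by near: s.
  have Zs : 0 < Z s by near: s.
  by rewrite (dln s dZs Zs).2.
apply: differentiableM => //; apply: differentiableM => //.
by apply: differentiableV => //; rewrite gt_eqF.
Unshelve. all: by end_near. Qed.

Lemma twice_differentiable_cst (n : nat) (a : R) (t : 'cV[R]_n) :
  twice_differentiable (fun=> a) t.
Proof.
split; first by near=> s; exact: differentiable_cst.
rewrite (_ : grad _ = cst 0); first exact: differentiable_cst.
by apply/funext => s; apply/colP => i; rewrite !mxE derive_cst.
Unshelve. all: by end_near. Qed.

End differentiability.

(** * A second-order Taylor inequality *)

Section second_order_bound.
Variables (R : realType) (n : nat).

(** Both sides are the limit of the same difference quotient. *)
Lemma is_derive_line (V W : normedModType R) (f : V -> W) (x d : V) (s : R) :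
  derivable f (x + s *: d) d ->
  is_derive s 1 (fun r => f (x + r *: d)) ('D_d f (x + s *: d)).
Proof.
have E : (fun h : R => h^-1 *: (f (x + (h *: 1 + s) *: d) - f (x + s *: d))) =
    (fun h : R => h^-1 *: (f (h *: d + (x + s *: d)) - f (x + s *: d))).
  apply/funext => h; congr (_ *: (f _ - _)).
  by rewrite scalerDl [h *: 1]mulr1 addrCA addrA.
move=> df; split; first by rewrite /derivable/= E.
by rewrite /derive/= E.
Qed.

(** The gradient is differentiable, so each partial derivative of [f] has a
    derivative along [d], and the Hessian collects their partial derivatives;
    expanding in the coordinates of [d] gives the form. *)
Lemma derive_grad_dot (f : 'cV[R]_n -> R) (t d : 'cV[R]_n) :
  differentiable (grad f) t ->
  is_derive t d (fun y => ((grad f y)^T *m d) ord0 ord0) (quad (hessian f t) d).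
Proof.
move=> dg; have dgi i := differentiable_colE _ _ _ _ _ i dg.
have -> : (fun y => ((grad f y)^T *m d) ord0 ord0) =
    \sum_i (fun y => d i ord0 * grad f y i ord0).
  apply/funext => y; rewrite fct_sumE mxE; apply: eq_bigr => i _.
  by rewrite mxE mulrC.
have -> : quad (hessian f t) d =
    \sum_i d i ord0 *: 'D_d (fun y => grad f y i ord0) t.
  rewrite /quad -mulmxA mxE; apply: eq_bigr => i _; rewrite mxE; congr (_ * _).
  rewrite derive_grad// !mxE; apply: eq_bigr => j _; rewrite !mxE; congr (_ * _).
  by congr ('D_ _ _ _); apply/funext => y; rewrite mxE.
apply: is_derive_sum => i; apply: is_deriveZ.
by apply: derivableP; exact: diff_derivable.
Qed.

Lemma le_of_is_derive_ge0 (h h' : R -> R) :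
  (forall s : R, 0 <= s <= 1 -> is_derive s 1 h (h' s)) ->
  (forall s : R, 0 <= s <= 1 -> 0 <= h' s) ->
  forall s, 0 <= s <= 1 -> h 0 <= h s.
Proof.
move=> dh h0 s /andP[s0 s1].
apply: (@ger0_derive1_le_cc _ h 0 1) => //.
- by move=> x; rewrite in_itv/= => /andP[/ltW x0 /ltW x1]; apply: ex_derive; apply: dh; rewrite x0.
- move=> x; rewrite in_itv/= => /andP[/ltW x0 /ltW x1].
  have x01 : 0 <= x <= 1 by rewrite x0.
  by have [_ dhx] := dh x x01; rewrite derive1E dhx h0.
- apply: derivable_within_continuous => x; rewrite in_itv/= => x01.
  by apply: ex_derive; apply: dh.
- by rewrite in_itv/= lexx ler01.
- by rewrite in_itv/= s0.
Qed.

(** Taylor's inequality on the segment [x, x + d]. Two monotonicity arguments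
    replace the integral remainder: the second derivative of
    [s |-> f (x + s d)] is at most [c], so its first derivative grows at rate at
    most [c], and then the function lies below a parabola. *)
Lemma le_second_order (f : 'cV[R]_n -> R) (x d : 'cV[R]_n) (c : R) :
  (forall s : R, 0 <= s <= 1 -> twice_differentiable f (x + s *: d)) ->
  (forall s : R, 0 <= s <= 1 -> quad (hessian f (x + s *: d)) d <= c) ->
  f (x + d) <= f x + ((grad f x)^T *m d) ord0 ord0 + c / 2.
Proof.
move=> df Hc; pose g (s : R) := f (x + s *: d).
pose g1 (s : R) : R := ((grad f (x + s *: d))^T *m d) ord0 ord0.
have dg (s : R) : 0 <= s <= 1 -> is_derive s 1 g (g1 s).
  move=> s01; have dfs : differentiable f (x + s *: d).
    exact: nbhs_singleton (df s s01).1.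
  rewrite /g1 -derive_grad//; apply: is_derive_line.
  exact: diff_derivable.
have dg1 (s : R) : 0 <= s <= 1 -> is_derive s 1 g1 (quad (hessian f (x + s *: d)) d).
  move=> s01; have [dh <-] := derive_grad_dot _ _ d (df s s01).2.
  exact: (is_derive_line _ _ (fun y => ((grad f y)^T *m d) ord0 ord0)).
have g1le (s : R) : 0 <= s <= 1 -> g1 s <= g1 0 + c * s.
  move=> s01.
  have := le_of_is_derive_ge0 (fun s => c * s - g1 s)
    (fun s => c - quad (hessian f (x + s *: d)) d) _ _ s s01.
  rewrite mulr0; move=> H; have {H} : 0 - g1 0 <= c * s - g1 s; last lra.
  apply: H => r r01; last by rewrite subr_ge0 Hc.
  have := dg1 r r01 => dg1r; apply: is_derive_eq.
  by rewrite [c *: _]mulr1.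
have H : 0 - g 0 <= g1 0 + c / 2 - g 1.
  have := le_of_is_derive_ge0 (fun s => g1 0 * s + c / 2 * s ^+ 2 - g s)
    (fun s => g1 0 + c * s - g1 s) _ _ 1 _.
  rewrite /= expr0n/= !mulr0 addr0 expr1n !mulr1; apply.
  - move=> s s01; have dgs := dg s s01.
    apply: is_derive_eq.
    rewrite /GRing.scale/=. lra.
  - by move=> s s01; rewrite subr_ge0 g1le.
  - by rewrite ler01 lexx.
by move: H; rewrite /g /g1 scale1r scale0r addr0; lra.
Qed.

End second_order_bound.

(** * Integrals against a density over a compact set *)

Section partition_function_bounds.
Variables (R : realType) (m : nat).

Lemma compact_measurable_cV (C : set 'cV[R]_m) : compact C -> measurable C.
Proof.
move=> cC; rewrite -[C]setCK; apply: measurableC; apply: open_measurable_mx.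
by apply: closed_openC; apply: compact_closed => //; exact: norm_hausdorff.
Qed.

Lemma within_continuous_measurable_cV (C : set 'cV[R]_m) (f : 'cV[R]_m -> R) :
  measurable C -> {within C, continuous f} -> measurable_fun C f.
Proof.
move=> mC cf; apply: (@measurability _ _ _ _ _ _ _ (RGenOpens.measurableE R)).
move=> _ [U [a [b ->]] <-].
have : open (f @^-1` `]a, b[%classic : set (subspace C)).
  by move/continuousP : cf; apply; exact: interval_open.
move=> /open_subspaceP[V oV VE].
by rewrite setIC -VE; apply: measurableI => //; exact: open_measurable_mx.
Qed.

End partition_function_bounds.

(** [f] is arbitrary, possibly not measurable: on the measurable subsets of [D]
    the measure agrees with the zero measure, which integrates everything to 0. *)
Lemma integral_null_set d (T : measurableType d) (R : realType)
    (mu : {measure set T -> \bar R}) (D : set T) (f : T -> \bar R) :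
  measurable D -> mu D = 0%E -> (\int[mu]_(x in D) f x = 0)%E.
Proof.
move=> mD D0; rewrite (@eq_measure_integral _ _ _ D mzero).
  exact: integral_measure_zero.
move=> A mA AD; rewrite /mzero; apply/eqP; rewrite -measure_le0 -D0.
by rewrite le_measure ?inE.
Qed.

Section partition_function.
Variables (R : realType) (m : nat) (C : set 'cV[R]_m) (f0 : 'cV[R]_m -> R).
Variables (tau b : R) (h : 'cV[R]_m -> R).
Hypotheses (mC : measurable C) (mf0 : measurable_fun C f0) (tau0 : 0 < tau).
Hypothesis (f0b : forall u, C u -> b <= f0 u).
Hypothesis (dh : probability_density h).

Let mhw : measurable_fun C (fun u => (h u * weight f0 tau u)%:E).
Proof.
apply/measurable_EFinP; apply: measurable_funM.
  by have [mh _ _] := dh; exact: measurable_funTS.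
apply: measurableT_comp; first exact: measurable_expR.
apply: measurableT_comp => //; exact: measurable_funM.
Qed.

Let hw0 u : 0 <= h u * weight f0 tau u.
Proof. by rewrite mulr_ge0 ?expR_ge0//; have [_ ? _] := dh. Qed.

Lemma integral_weight_le :
  (\int[lebesgue_cV R m]_(u in C) (h u * weight f0 tau u)%:E
    <= (expR (- (b / tau)))%:E)%E.
Proof.
have [mh h0 h1] := dh; have mhE : measurable_fun setT (EFin \o h).
  exact/measurable_EFinP.
have -> : (expR (- (b / tau)))%:E =
    ((expR (- (b / tau)))%:E * \int[lebesgue_cV R m]_u (h u)%:E)%E.
  by rewrite h1 mule1.
rewrite -ge0_integralZl//; last first.
- by move=> u _; rewrite lee_fin.
apply: (@le_trans _ _
  (\int[lebesgue_cV R m]_(u in C) ((expR (- (b / tau)))%:E * (h u)%:E))%E).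
  apply: ge0_le_integral => //.
  - by move=> u _; rewrite lee_fin.
  - by apply: measurable_funeM; exact: measurable_funTS.
  - move=> u Cu; rewrite -EFinM lee_fin mulrC ler_wpM2r//.
    by rewrite ler_expR lerN2 ler_pM2r ?invr_gt0// f0b.
apply: ge0_subset_integral => //; first exact: measurable_funeM.
by move=> u _; rewrite mule_ge0// lee_fin ?expR_ge0.
Qed.

(** The integral is finite, so that its real-valued version is not a default
    value. *)
Lemma EFin_integral_weight :
  (\int[lebesgue_cV R m]_(u in C) (h u * weight f0 tau u))%:E =
  (\int[lebesgue_cV R m]_(u in C) (h u * weight f0 tau u)%:E)%E.
Proof.
rewrite fineK// ge0_fin_numE; last first.
  by apply: integral_ge0 => u _; rewrite lee_fin.
exact: le_lt_trans integral_weight_le (ltry _).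
Qed.

(** A nonnegative integrand with zero integral vanishes almost everywhere, whereas
    this one is positive on the non-null set [C]. *)
Lemma integral_weight_gt0 : (forall u, C u -> 0 < h u) ->
  lebesgue_cV R m C != 0%E ->
  0 < \int[lebesgue_cV R m]_(u in C) (h u * weight f0 tau u).
Proof.
move=> h0 C0; rewrite lt_neqAle Rintegral_ge0// andbT.
apply: contra_neq C0 => I0.
have : (\int[lebesgue_cV R m]_(u in C) `|(h u * weight f0 tau u)%:E| = 0)%E.
  under eq_integral do rewrite gee0_abs ?lee_fin ?hw0//.
  by rewrite -EFin_integral_weight -I0.
move=> /ae_eq_integral_abs -/(_ mC mhw) [N [mN N0 CN]].
apply/eqP; rewrite -measure_le0 -N0 le_measure ?inE//.
move=> u Cu; apply: CN => /= /(_ Cu) [] /eqP.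
by rewrite mulf_eq0 gt_eqF ?h0//= gt_eqF ?expR_gt0.
Qed.

End partition_function.

(** * Telescoping a descent inequality *)

Section telescoping.
Variables (R : realType) (a q : nat -> R) (c l : R).
Hypotheses (c0 : 0 < c) (q0 : forall k, 0 <= q k).
Hypothesis decr : forall k, a k.+1 <= a k - c * q k.
Hypothesis la : forall k, l <= a k.

Let partial_le n : \sum_(0 <= k < n) q k <= (a 0%N - l) / c.
Proof.
rewrite ler_pdivlMr// mulrC mulr_sumr.
suff : \sum_(0 <= k < n) c * q k <= a 0%N - a n by have := la n; lra.
elim: n => [|n IH]; first by rewrite big_geq// subrr.
by rewrite big_nat_recr//=; have := decr n; lra.
Qed.

Lemma telescoping_nneseries :
  (\sum_(0 <= k <oo) (q k)%:E <= ((a 0%N - l) / c)%:E)%E.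
Proof.
apply: lime_le; first by apply: is_cvg_nneseries => k _ _; rewrite lee_fin.
by near=> n; rewrite sumEFin lee_fin; exact: partial_le.
Unshelve. all: by end_near. Qed.

(** [K] times the minimum is at most the sum of the first [K] terms. *)
Lemma telescoping_bigmin (K : nat) : (1 <= K)%N ->
  \big[Order.min/q 0%N]_(0 <= j < K) q j <= (a 0%N - l) / (K%:R * c).
Proof.
set mn := \big[_/_]_(_ <= _ < _) _ => K1.
have mn_le : mn *+ K <= \sum_(0 <= k < K) q k.
  rewrite -[X in mn *+ X]subn0 -sumr_const_nat; apply: ler_sum_nat => j jK.
  by apply: ge_bigmin_seq; rewrite // mem_index_iota.
rewrite invfM mulrA mulrAC ler_pdivlMr ?ltr0n// mulr_natr.
exact: le_trans mn_le (partial_le K).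
Qed.

Lemma telescoping_cvg0 : q @ \oo --> (0 : R).
Proof.
apply: cvg_series_cvg_0; apply: nondecreasing_is_cvgn.
  by apply/nondecreasing_seqP => n; rewrite /series/= big_nat_recr//= lerDl.
by exists ((a 0%N - l) / c) => _ [n _ <-]; exact: partial_le.
Qed.

End telescoping.

(** * Regularity of the reduced objective *)

Section reduced_objective_regularity.
Variables (R : realType) (m p : nat).
Variables (C : set 'cV[R]_m) (f0 : 'cV[R]_m -> R) (tau : R).
Variables (Theta : set 'cV[R]_p) (dens : 'cV[R]_p -> 'cV[R]_m -> R).
Hypotheses (C0 : C !=set0) (cC : compact C) (cf0 : {within C, continuous f0}).
Hypothesis tau0 : 0 < tau.
Hypothesis densP : forall t, Theta t -> probability_density (dens t).
Hypothesis dens_gt0 : forall t u, Theta t -> C u -> 0 < dens t u.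

Let mC : measurable C := compact_measurable_cV _ _ _ cC.
Let mf0 : measurable_fun C f0 :=
  within_continuous_measurable_cV _ _ _ _ mC cf0.

(** Let [b] be the minimum of [f0] on [C]. Then [Z <= exp (- b / tau)] because the
    density has mass at most 1 on [C], so [F >= b] wherever [Z > 0]. If [C] is a
    null set then [Z = 0] and [F = 0], since [ln 0 = 0]; hence the bound
    [min 0 b]. *)
Lemma reduced_objective_bounded_below :
  has_lbound [set reduced_objective C f0 tau dens t | t in Theta].
Proof.
have [u0 _ f0min] := compact_EVT_min C0 cC cf0.
have f0b u : C u -> f0 u0 <= f0 u by move=> Cu; apply: f0min; rewrite inE.
exists (Num.min 0 (f0 u0)) => _ [t Tt <-]; rewrite ge_min /reduced_objective.
have := integral_weight_le _ _ _ _ _ _ _ mC mf0 tau0 f0b (densP t Tt).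
rewrite -(EFin_integral_weight _ _ _ _ _ _ _ mC mf0 tau0 f0b (densP t Tt)).
rewrite -/(partition_function C f0 tau dens t) lee_fin => Zle.
have [Z0|Z0] := leP (partition_function C f0 tau dens t) 0.
  by rewrite ln0// mulr0 lexx.
apply/orP; right; rewrite mulNr lerNr mulrC -ler_pdivlMr// mulNr.
by rewrite -[leRHS]expRK ler_ln ?posrE ?expR_gt0.
Qed.

(** If [C] has positive measure then [Z t > 0] and [F = - tau ln Z] inherits the
    regularity of [Z]. If [C] is a null set, [Z] vanishes for every parameter,
    even outside [Theta], so [F] is constant. *)
Lemma twice_differentiable_reduced_objective t : Theta t ->
  twice_differentiable (partition_function C f0 tau dens) t ->
  twice_differentiable (reduced_objective C f0 tau dens) t.
Proof.
move=> Tt dZ; have [muC|muC] := eqVneq (lebesgue_cV R m C) 0%E.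
  rewrite (_ : reduced_objective _ _ _ _ = fun=> 0).
    exact: twice_differentiable_cst.
  apply/funext => s; rewrite /reduced_objective /partition_function.
  by rewrite /Rintegral integral_null_set// ln0// mulr0.
have [u0 _ f0min] := compact_EVT_min C0 cC cf0.
have f0b u : C u -> f0 u0 <= f0 u by move=> Cu; apply: f0min; rewrite inE.
apply: twice_differentiable_ln => //.
apply: (integral_weight_gt0 _ _ _ _ _ _ _ mC mf0 tau0 f0b (densP t Tt)) => //.
by move=> u; exact: dens_gt0.
Qed.

End reduced_objective_regularity.

(** * Preconditioned gradient descent on the reduced objective *)

Lemma posdef_possemidef (R : realType) (n : nat) (P : 'M[R]_n) :
  posdef P -> possemidef P.
Proof.
move=> [PT P0]; split=> // x; have [->|/P0/ltW//] := eqVneq x 0.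
by rewrite /quad mulmx0 mxE.
Qed.

Lemma quadZ (R : realType) (n : nat) (A : 'M[R]_n) (a : R) (x : 'cV[R]_n) :
  quad A (a *: x) = a ^+ 2 * quad A x.
Proof.
have aT : (a *: x)^T = a *: x^T by apply/matrixP => i j; rewrite !mxE.
by rewrite /quad aT -!scalemxAl -scalemxAr scalerA -expr2 mxE.
Qed.

(** The descent lemma in the metric of [P]. Put [d = y - x = - eta P g] with
    [g = grad f x]. The linear term of the Taylor inequality is [- eta g^T P g],
    and the second-order term is at most [eta^2 L (g^T P g) / 2] because the form
    of the Hessian at [P g] is at most [L (g^T P g)]. *)
Lemma preconditioned_descent (R : realType) (n : nat) (f : 'cV[R]_n -> R)
    (P : 'M[R]_n) (x : 'cV[R]_n) (L eta : R) :
  possemidef P -> 0 < L ->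
  let y := x - eta *: (P *m grad f x) in
  (forall s : R, 0 <= s <= 1 -> twice_differentiable f (x + s *: (y - x))) ->
  (forall s : R, 0 <= s <= 1 ->
     spectral_norm (sqrtmx P *m hessian f (x + s *: (y - x)) *m sqrtmx P) <= L) ->
  f y <= f x - eta * (1 - eta * L / 2) * quad P (grad f x).
Proof.
move=> Ppsd L0 y df Hf; set g := grad f x.
have [PT _] := Ppsd.
have yx : y - x = - eta *: (P *m g) by rewrite /y addrAC subrr add0r scaleNr.
have := le_second_order _ _ f x (y - x) (eta ^+ 2 * (L * quad P g)) df.
rewrite [x + (y - x)]addrC subrK.
have -> : ((grad f x)^T *m (y - x)) ord0 ord0 = - eta * quad P g.
  by rewrite yx -scalemxAr mxE mulmxA.
move=> H; have {H} := H _; set rhs := (X in _ <= X).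
have -> : f x - eta * (1 - eta * L / 2) * quad P g = rhs by rewrite /rhs; field.
apply=> s s01; have -> : quad (hessian f (x + s *: (y - x))) (y - x) =
   eta ^+ 2 * quad (hessian f (x + s *: (y - x))) (P *m g).
  by rewrite [X in quad _ X = _]yx quadZ sqrrN.
rewrite ler_wpM2l ?sqr_ge0//; apply: quad_preconditioned_le => //.
exact: Hf.
Qed.

Theorem theorem1 (R : realType) (m p : nat)
    (C : set 'cV[R]_m) (f0 : 'cV[R]_m -> R) (tau : R)
    (Theta : set 'cV[R]_p) (dens : 'cV[R]_p -> 'cV[R]_m -> R)
    (P : 'M[R]_p) (LP eta : R) (theta : nat -> 'cV[R]_p) :
  C !=set0 -> compact C ->
  {within C, continuous f0} ->
  0 < tau ->
  (forall t, Theta t -> probability_density (dens t)) ->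
  (forall t u, Theta t -> C u -> 0 < dens t u) ->
  (forall u, C u -> C2_on Theta (dens ^~ u)) ->
  leibniz_rule_order2 C f0 tau Theta dens ->
  let F := reduced_objective C f0 tau dens in
  posdef P ->
  0 < LP ->
  (ereal_sup [set (spectral_norm (sqrtmx P *m hessian F t *m sqrtmx P))%:E
             | t in Theta] <= LP%:E)%E ->
  (forall k, theta k.+1 = theta k - eta *: (P *m grad F (theta k))) ->
  (forall k (s : R), 0 <= s <= 1 ->
     Theta (theta k + s *: (theta k.+1 - theta k))) ->
  0 < eta -> eta < 2 / LP ->
  let c := eta * (1 - eta * LP / 2) in
  let gap := F (theta 0%N) - inf [set F t | t in Theta] in
  [/\ forall k, F (theta k.+1) <= F (theta k) - c * quad P (grad F (theta k)),
      (\sum_(0 <= k <oo) (quad P (grad F (theta k)))%:E <= (gap / c)%:E)%E,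
      forall K : nat, (1 <= K)%N ->
        \big[Order.min/quad P (grad F (theta 0%N))]_(0 <= j < K)
          quad P (grad F (theta j)) <= gap / (K%:R * c) &
      wnorm P (grad F (theta k)) @[k --> \oo] --> (0 : R)].
Proof.
move=> C0 cC cf0 tau0 densP dens_gt0 _ leibniz F Ppos LP0 HLP step segment eta0.
move=> etaLP c gap; have Ppsd := posdef_possemidef _ _ _ Ppos.
have thetaT k : Theta (theta k).
  by have := segment k 0; rewrite scale0r addr0 lexx ler01; apply.
have dF t : Theta t -> twice_differentiable F t.
  move=> Tt; apply: (twice_differentiable_reduced_objective _ _ _ _ _ _ Theta) => //.
  by have [] := leibniz t Tt.
have HF t : Theta t -> spectral_norm (sqrtmx P *m hessian F t *m sqrtmx P) <= LP.
  move=> Tt; rewrite -lee_fin; apply: le_trans HLP.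
  by apply: ereal_sup_ubound; exists t.
have decr k : F (theta k.+1) <= F (theta k) - c * quad P (grad F (theta k)).
  rewrite /c {1}step; apply: preconditioned_descent => // s s01; rewrite -step.
    exact/dF/segment.
  exact/HF/segment.
have c0 : 0 < c.
  move: etaLP; rewrite ltr_pdivlMr// => etaLP.
  by rewrite mulr_gt0// subr_gt0 ltr_pdivrMr// mul1r.
have q0 k : 0 <= quad P (grad F (theta k)) by have [_] := Ppsd; apply.
have Fge k : inf [set F t | t in Theta] <= F (theta k).
  apply: ge_inf; last by exists (theta k).
  exact: reduced_objective_bounded_below.
split=> //.
- exact: (telescoping_nneseries _ (fun k => F (theta k))).
- exact: (telescoping_bigmin _ (fun k => F (theta k))).
- have := telescoping_cvg0 _ (fun k => F (theta k)) _ _ _ c0 q0 decr Fge.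
  have := @sqrt_continuous R 0; rewrite /continuous_at sqrtr0 => sc qcvg.
  exact: (cvg_comp _ _ qcvg sc).
Qed.
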